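(* Let $\mathcal{X},\mathcal{Y}$ be finite sets, $n\ge 1$, let $\mathcal{A}:\mathcal{X}^n\to\mathcal{Y}$ be an algorithm and let $\boldsymbol{S}$ be a random dataset over $\mathcal{X}^n$ (with an arbitrary distribution). Assume that $R:\mathcal{Y}\to 2^{\mathcal{X}^n}$ is such that for every $y\in\mathcal{Y}$, $\Pr[\boldsymbol{S}\in R(y)]\le\beta$. Then $\Pr[\boldsymbol{S}\in R(\mathcal{A}(\boldsymbol{S}))]\le|\mathcal{Y}|\cdot\beta$.
   Context: $2^{\mathcal{X}^n}$ denotes the set of all subsets of $\mathcal{X}^n$. A dataset is an element of $\mathcal{X}^n$. The paper restricts random variables to finite domains. *)

(* Defs.v *)
(* MathComp world, with MathComp-Analysis for probability spaces. *)
From HB Require Import structures.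
From mathcomp Require Import all_boot all_order all_algebra.
From mathcomp Require Import all_classical all_reals all_analysis.

Set Implicit Arguments.
Unset Strict Implicit.
Unset Printing Implicit Defensive.

Import Order.TTheory GRing.Theory Num.Theory.
Local Open Scope classical_set_scope.
Local Open Scope ring_scope.
Local Open Scope ereal_scope.

(* A finite type carries its full power set as sigma-algebra, so measurability
   of a map into it reduces to measurability of its fibers. *)
Definition finite_rv (d : measure_display) (T : measurableType d)
    (F : finType) (X : T -> F) : Prop :=
  forall a : F, measurable (X @^-1` [set a]).

(* An algorithm with input s and internal randomness c outputs A s c; on each
   input the output must be a random variable of c. Deterministic algorithms
   are those that ignore c (e.g. C := unit). *)
Definition algorithm (d : measure_display) (C : measurableType d)
    (I : Type) (Y : finType) (A : I -> C -> Y) : Prop :=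
  forall s : I, finite_rv (A s).

Definition independent_rv (R : realType) (d d' : measure_display)
    (T : measurableType d) (P : probability T R) (F : finType)
    (C : measurableType d') (X : T -> F) (U : T -> C) : Prop :=
  forall (a : F) (B : set C), measurable B ->
    P (X @^-1` [set a] `&` U @^-1` B) = P (X @^-1` [set a]) * P (U @^-1` B).

(* Main.v *)
Require Import Defs.
From HB Require Import structures.
From mathcomp Require Import all_boot all_order all_algebra.
From mathcomp Require Import all_classical all_reals all_analysis.

Set Implicit Arguments.
Unset Strict Implicit.
Unset Printing Implicit Defensive.

Import Order.TTheory GRing.Theory Num.Theory.
Local Open Scope classical_set_scope.
Local Open Scope ring_scope.
Local Open Scope ereal_scope.

(** Union bound over outputs: if the dataset lies in [Bad] of the actual output, it lies in [Bad y]
    for some fixed [y], so the event is covered by [#|Y|] events of probability at most [beta] each.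
    Subadditivity is applied to measurable events; the two lemmas below supply measurability by
    cutting along the finitely many values of a variable. *)

Lemma measurable_finite_rv_preimage (d : measure_display)
    (T : measurableType d) (F : finType) (f : T -> F) (V : set F) :
  finite_rv f -> measurable (f @^-1` V).
Proof.
move=> hf; rewrite (_ : _ @^-1` _ = \bigcup_(a in V) f @^-1` [set a]).
  by apply: fin_bigcup_measurable => //; exact: finite_finset.
by apply/seteqP; split => [w Vw|w [a Va /= ->]] //; exists (f w).
Qed.

(** On the slice where [S] equals [s] the condition only constrains [U], so the event is a finite
    union of measurable slices. This handles events that depend on both the dataset and the internal
    randomness. *)
Lemma measurable_finite_rv_pair (d d' : measure_display)
    (T : measurableType d) (C : measurableType d') (F : finType)
    (S : T -> F) (U : T -> C) (B : F -> set C) :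
  finite_rv S -> measurable_fun setT U -> (forall s, measurable (B s)) ->
  measurable [set w | B (S w) (U w)].
Proof.
move=> hS hU hB.
rewrite (_ : mkset _ = \bigcup_s (S @^-1` [set s] `&` U @^-1` B s)).
  apply: fin_bigcup_measurable => [|s _]; first exact: finite_finset.
  by apply: measurableI => //; rewrite -[X in measurable X]setTI; exact: hU.
apply/seteqP; split => [w Bw|w [s _ [/= <-]]] //.
by exists (S w).
Qed.

Theorem theorem9 (R : realType) (d d' : measure_display)
  (Omega : measurableType d) (Pr : probability Omega R)
  (X Y : finType) (n : nat) (hn : (1 <= n)%N)
  (C : measurableType d') (A : n.-tuple X -> C -> Y) (hA : algorithm A)
  (S : Omega -> n.-tuple X) (hS : finite_rv S)
  (U : Omega -> C) (hU : measurable_fun setT U)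
  (hSU : independent_rv Pr S U)
  (Bad : Y -> {set n.-tuple X}) (beta : R)
  (hBad : forall y : Y, Pr [set w | S w \in Bad y] <= beta%:E) :
  Pr [set w | S w \in Bad (A (S w) (U w))] <= (#|Y|%:R * beta)%:E.
Proof.
have mBad y : measurable [set w | S w \in Bad y].
  exact: (measurable_finite_rv_preimage [set s | s \in Bad y] hS).
have mE : measurable [set w | S w \in Bad (A (S w) (U w))].
  (* For a fixed dataset [s], [B s] is the set of coins leading to a bad output; it is measurable by
     [hA s]. *)
  apply: (measurable_finite_rv_pair (B := fun s => [set c | s \in Bad (A s c)]))
    => // s.
  exact: (measurable_finite_rv_preimage [set y | s \in Bad y] (hA s)).
apply: (@le_trans _ _ (\sum_(y : Y) Pr [set w | S w \in Bad y])).
  (* The sum over the type [Y] becomes one over a finite set, the form used by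
     [content_sub_fsum]. *)
  rewrite (fsbig_seq _ _ (index_enum_uniq Y)).
  apply: content_sub_fsum => // w Ew.
  (* The covering index at [w] is the output produced at [w]. *)
  by exists (A (S w) (U w)); rewrite //= mem_index_enum.
apply: (@le_trans _ _ (\sum_(y : Y) beta%:E)); first exact: lee_sum.
by rewrite sumEFin sumr_const mulr_natl.
Qed.
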